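(* For each odd prime $p$, there exists a non-Schurian association scheme with the same intersection numbers as the Schurian scheme $(V,\mathcal{R}_G)$, where $V=\mathbb{F}_p^3$, $G$ is the group of permutations of $V$ generated by $\{\tau_y,\iota\mid y\in V\}$ with $\tau_y(x)=x+y$ and $\iota((x_1,x_2,x_3))=(x_1+x_2,\,x_2+x_3,\,x_3)$, and $\mathcal{R}_G$ is the set of orbits of the induced action of $G$ on $V\times V$.
   Context: An association scheme $(X,S)$ consists of a non-empty finite set $X$ and a partition $S$ of $X\times X$ such that: (i) $1_X:=\{(x,x)\mid x\in X\}\in S$; (ii) for each $s\in S$, $s^*:=\{(x,y)\mid (y,x)\in s\}\in S$; (iii) for all $s,t,u\in S$ the number $c_{st}^u:=|xs\cap yt^*|$ is constant whenever $(x,y)\in u$, where $xs:=\{y\in X\mid (x,y)\in s\}$. The $c_{st}^u$ are the intersection numbers. For a transitive permutation group $G$ on a finite set $\Omega$, $(\Omega,\mathcal{R}_G)$ is an association scheme, where $\mathcal{R}_G$ is the set of orbits of the induced action of $G$ on $\Omega\times\Omega$. An association scheme $(X,S)$ is Schurian if $S=\mathcal{R}_G$ for some transitive permutation group $G$ on $X$, and non-Schurian otherwise. Two association schemes $(X,S)$ and $(X_1,S_1)$ have the same intersection numbers (are algebraically isomorphic) if there is a bijection $\iota:S\to S_1$ with $c_{rs}^t=c_{r^\iota s^\iota}^{t^\iota}$ for all $r,s,t\in S$. *)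

(* Defs.v *)
From mathcomp Require Import all_boot all_order all_algebra all_fingroup.

Set Implicit Arguments.
Unset Strict Implicit.
Unset Printing Implicit Defensive.

Import GRing.Theory.
Local Open Scope ring_scope.

Section Schemes.
Variable X : finType.
Implicit Types (s t u : {set X * X}) (S : {set {set X * X}}) (x y : X).

Definition diagonal : {set X * X} := [set w | w.1 == w.2].

Definition converse s : {set X * X} := [set w | (w.2, w.1) \in s].

Definition neighbours x s : {set X} := [set y | (x, y) \in s].

Definition num_paths s t x y : nat :=
  #|neighbours x s :&: neighbours y (converse t)|.

Definition association_scheme S : Prop :=
  [/\ (0 < #|X|)%N,
      partition S [set: X * X],
      diagonal \in S,
      forall s, s \in S -> converse s \in S
    & forall s t u, s \in S -> t \in S -> u \in S ->
      forall x y x' y', (x, y) \in u -> (x', y') \in u ->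
      num_paths s t x y = num_paths s t x' y'].

(* c_{st}^u, evaluated at an arbitrarily chosen pair of u; by [inter_numE] the
   choice is immaterial in an association scheme. *)
Definition inter_num s t u : nat :=
  if [pick w in u] is Some w then num_paths s t w.1 w.2 else 0%N.

Lemma inter_numE S s t u x y :
  association_scheme S -> s \in S -> t \in S -> u \in S -> (x, y) \in u ->
  inter_num s t u = num_paths s t x y.
Proof.
case=> _ _ _ _ cS sS tS uS xyu; rewrite /inter_num.
case: pickP => [[x' y'] /= x'y'u | /(_ (x, y))]; last by rewrite xyu.
exact: cS x'y'u xyu.
Qed.

Definition pair_act (w : X * X) (g : {perm X}) : X * X := (g w.1, g w.2).

Lemma pair_act1 : pair_act^~ 1%g =1 id.
Proof. by case=> x y; rewrite /pair_act !perm1. Qed.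

Lemma pair_actM w : act_morph pair_act w.
Proof. by case: w => x y g h; rewrite /pair_act !permM. Qed.

Definition pair_action := TotalAction pair_act1 pair_actM.

Definition orbitals (G : {group {perm X}}) : {set {set X * X}} :=
  orbit pair_action G @: [set: X * X].

Definition schurian S : Prop :=
  exists2 G : {group {perm X}},
    [transitive G, on [set: X] | 'P] & S = orbitals G.

Lemma mem_orbital (G : {group {perm X}}) s g x y :
  s \in orbitals G -> g \in G -> ((g x, g y) \in s) = ((x, y) \in s).
Proof.
case/imsetP=> w _ -> gG.
exact: (orbit_actr pair_action w (x, y) gG).
Qed.

Lemma orbitals_scheme (G : {group {perm X}}) :
  [transitive G, on [set: X] | 'P] -> association_scheme (orbitals G).
Proof.
move=> trG; have [x0 _ _] := imsetP trG.
have tr x y : exists2 g, g \in G & y = g x.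
  by have [g gG ->] := atransP2 trG (in_setT x) (in_setT y); exists g.
split.
- by apply/card_gt0P; exists x0.
- by apply: orbit_partition; apply/actsP=> g _ w; rewrite !inE.
- apply/imsetP; exists (x0, x0) => //; apply/setP=> -[x y]; rewrite !inE /=.
  apply/eqP/orbitP => [<- | [g gG [<- <-]] //].
  by have [g gG ->] := tr x0 x; exists g.
- move=> s /imsetP[[x y] _ ->]; apply/imsetP; exists (y, x) => //.
  apply/setP=> -[a b]; rewrite inE /=.
  by apply/orbitP/orbitP => -[g gG [<- <-]]; exists g.
move=> s t u sS tS /imsetP[w _ ->] x y x' y' wxy wx'y'.
have: (x', y') \in orbit pair_action G (x, y).
  by rewrite (orbit_eqP wxy).
case/orbitP=> g gG [<- <-]; rewrite /num_paths.
rewrite -(card_imset (mem (neighbours x s :&: _)) (@perm_inj _ g)).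
apply: eq_card => z; rewrite -(permKV g z) (mem_imset _ _ (@perm_inj _ g)).
by rewrite !inE /= !(mem_orbital _ _ _ gG).
Qed.

End Schemes.

Definition same_intersection_numbers (X X1 : finType)
    (S : {set {set X * X}}) (S1 : {set {set X1 * X1}}) : Prop :=
  exists f : {set X * X} -> {set X1 * X1},
    [/\ {in S &, injective f},
        f @: S = S1
      & forall r s t, r \in S -> s \in S -> t \in S ->
        inter_num r s t = inter_num (f r) (f s) (f t)].

Section JordanGroup.
Variable p : nat.
Local Notation V := 'rV['F_p]_3.

Definition translation (y : V) : {perm V} := perm (addIr y).

(* Coordinates are numbered from 0. *)
Definition jordan_fun (x : V) : V :=
  \row_(i < 3) [:: x 0 0 + x 0 1; x 0 1 + x 0 2; x 0 2]`_i.

Lemma jordan_fun_inj : injective jordan_fun.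
Proof.
move=> x y /rowP E.
have := E 2; rewrite !mxE /= => E2.
have := E 1; rewrite !mxE /= E2 => /addIr E1.
have := E 0; rewrite !mxE /= E1 => /addIr E0.
apply/rowP=> -[[|[|[|//]]] lti].
- by rewrite (_ : Ordinal lti = 0) //; apply: val_inj.
- by rewrite (_ : Ordinal lti = 1) //; apply: val_inj.
- by rewrite (_ : Ordinal lti = 2) //; apply: val_inj.
Qed.

Definition jordan_perm : {perm V} := perm jordan_fun_inj.

Definition jordan_group : {group {perm V}} :=
  <<[set translation y | y : V] :|: [set jordan_perm]>>%G.

Lemma jordan_group_trans : [transitive jordan_group, on [set: V] | 'P].
Proof.
apply/imsetP; exists 0 => //; apply/setP=> y; rewrite inE; symmetry.
apply/orbitP; exists (translation y); last by rewrite /= apermE permE add0r.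
by apply: mem_gen; rewrite inE imset_f.
Qed.

End JordanGroup.

(* Main.v *)
Require Import Defs.
From mathcomp Require Import all_boot all_order all_algebra all_fingroup.
From mathcomp Require Import ring.

(* Write x - y = (a, b, c). The orbitals of the group are labelled by (c, q) with
   q = b^2 - bc - 2ac if c <> 0, by b if c = 0 <> b, and by a if b = c = 0. The
   labels b of the pairs inside one plane c = const interact very weakly with
   the other relations: for x, y in such a plane with different middle
   coordinates, a path from x to y of given labels through another plane is
   always unique. Hence, in each plane separately, b may be rescaled by a
   nonzero constant eps without changing the intersection numbers. Taking
   eps = -1 on the plane c = 0 and eps = 1 elsewhere destroys transitivity of
   the automorphism group. *)

Set Implicit Arguments.
Unset Strict Implicit.
Unset Printing Implicit Defensive.

Import GRing.Theory.
Local Open Scope ring_scope.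

Lemma card_unique (T : finType) (A : {set T}) (z0 : T) :
  (forall z, z \in A <-> z = z0) -> #|A| = 1%N.
Proof.
move=> H; apply/eqP/cards1P; exists z0; apply/setP=> z; rewrite [RHS]inE.
by apply/idP/eqP => /H.
Qed.

(** * Association schemes given by colourings of pairs *)

Section Colourings.
Variables (X : finType) (T : eqType) (col : X -> X -> T).

Definition fibre (k : T) : {set X * X} := [set w | col w.1 w.2 == k].

(** Indexing by pairs rather than by colours keeps every class nonempty, as a partition requires. *)
Definition fibres : {set {set X * X}} :=
  [set fibre (col w.1 w.2) | w : X * X].

Definition paths (k1 k2 : T) (x y : X) : {set X} :=
  [set z | (col x z == k1) && (col z y == k2)].

Lemma fibresP (s : {set X * X}) :
  reflect (exists x y, s = fibre (col x y)) (s \in fibres).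
Proof.
apply: (iffP imsetP) => [[[x y] _ ->] | [x [y ->]]]; first by exists x, y.
by exists (x, y).
Qed.

Lemma mem_fibres x y : fibre (col x y) \in fibres.
Proof. by apply/fibresP; exists x, y. Qed.

Lemma fibres_partition : partition fibres [set: X * X].
Proof.
have -> : fibres = preim_partition (fun w => col w.1 w.2) [set: X * X].
  apply/setP=> s; apply/imsetP/imsetP => -[w _ ->]; exists w => //.
    by apply/setP=> v; rewrite !inE eq_sym.
  by apply/setP=> v; rewrite !inE eq_sym.
exact: preim_partitionP.
Qed.

Lemma num_paths_fibre k1 k2 x y :
  num_paths (fibre k1) (fibre k2) x y = #|paths k1 k2 x y|.
Proof. by apply: eq_card => z; rewrite !inE. Qed.

Lemma fibres_scheme (x0 : X) (conv : T -> T) :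
    (forall x y, (col x y == col x0 x0) = (x == y)) ->
    involutive conv -> (forall x y, col y x = conv (col x y)) ->
    (forall x1 y1 x2 y2 x y x' y', col x y = col x' y' ->
      #|paths (col x1 y1) (col x2 y2) x y| =
      #|paths (col x1 y1) (col x2 y2) x' y'|) ->
  association_scheme fibres.
Proof.
move=> diag convK conv_col path_col; split.
- by apply/card_gt0P; exists x0.
- exact: fibres_partition.
- apply/fibresP; exists x0, x0; apply/setP=> w.
  by rewrite !inE diag.
- move=> _ /fibresP[x [y ->]]; apply/fibresP; exists y, x.
  by apply/setP=> w; rewrite !inE /= !(conv_col _ w.2) (conv_col x y)
    ?(can_eq convK) -1?(can_eq convK) ?convK.
move=> _ _ _ /fibresP[x1 [y1 ->]] /fibresP[x2 [y2 ->]] /fibresP[x3 [y3 ->]].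
move=> x y x' y'; rewrite !inE /= => /eqP xy /eqP xy'.
by rewrite !num_paths_fibre; apply: path_col; rewrite xy xy'.
Qed.

(** A group whose orbitals are the fibres preserves every colour. To refute Schurity it is thus
    enough to find two points that no colour-preserving permutation connects. *)
Lemma schurian_fibres : schurian fibres -> forall x y, exists g : {perm X},
  g x = y /\ forall a b, col (g a) (g b) = col a b.
Proof.
case=> G trG E x y.
have [g gG ->] := atransP2 trG (in_setT x) (in_setT y).
exists g; split=> // a b; apply/eqP.
have sG : fibre (col a b) \in orbitals G by rewrite -E mem_fibres.
by have := mem_orbital a b sG gG; rewrite !inE /= eqxx.
Qed.

(** Made into a group below, so that a generated group can be bounded by checking its generators. *)
Definition colour_auts : {set {perm X}} :=
  [set g : {perm X} | [forall a, forall b, col (g a) (g b) == col a b]].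

Lemma colour_autsP (g : {perm X}) :
  reflect (forall a b, col (g a) (g b) = col a b) (g \in colour_auts).
Proof.
rewrite inE; apply: (iffP forallP) => [H a b | H a].
  exact/eqP/(forallP (H a)).
by apply/forallP=> b; apply/eqP.
Qed.

Lemma group_set_colour_auts : group_set colour_auts.
Proof.
apply/group_setP; split; first by apply/colour_autsP=> a b; rewrite !perm1.
move=> g h /colour_autsP gP /colour_autsP hP; apply/colour_autsP=> a b.
by rewrite !permM hP gP.
Qed.
Canonical colour_auts_group := Group group_set_colour_auts.

End Colourings.

(** The algebraic isomorphism pairs off classes of equal colour. *)
Lemma same_intersection_numbers_fibres (X X1 : finType) (T : eqType)
    (col : X -> X -> T) (col1 : X1 -> X1 -> T) :
    association_scheme (fibres col) -> association_scheme (fibres col1) ->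
    (forall x y, exists x1 y1, col1 x1 y1 = col x y) ->
    (forall x1 y1, exists x y, col x y = col1 x1 y1) ->
    (forall a b c d x y x1 y1, col x y = col1 x1 y1 ->
      #|paths col (col a b) (col c d) x y| =
      #|paths col1 (col a b) (col c d) x1 y1|) ->
  same_intersection_numbers (fibres col) (fibres col1).
Proof.
move=> sch sch1 sub sub1 path_col.
(* Collecting all pairs that share a colour with a member of [s] avoids choosing a
   representative. *)
pose f (s : {set X * X}) : {set X1 * X1} :=
  [set w | [exists v in s, col v.1 v.2 == col1 w.1 w.2]].
have fE x y : f (fibre col (col x y)) = fibre col1 (col x y).
  apply/setP=> -[x1 y1]; rewrite !inE /=; apply/exists_inP/eqP.
    by case=> -[x' y']; rewrite inE /= => /eqP-> /eqP.
  by move=> E; exists (x, y); rewrite ?inE /= ?E.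
exists f; split.
- move=> _ _ /fibresP[x [y ->]] /fibresP[x' [y' ->]].
  have [x1 [y1 E]] := sub x y.
  rewrite !fE => /setP/(_ (x1, y1)); rewrite !inE /= E eqxx.
  by move=> /esym/eqP->.
- apply/setP=> s; apply/imsetP/fibresP.
    case=> _ /fibresP[x [y ->]] ->; have [x1 [y1 E]] := sub x y.
    by exists x1, y1; rewrite fE E.
  case=> x1 [y1 ->]; have [x [y E]] := sub1 x1 y1.
  by exists (fibre col (col x y)); rewrite ?mem_fibres // fE E.
move=> _ _ _ /fibresP[a [b ->]] /fibresP[c [d ->]] /fibresP[x [y ->]].
have [a1 [b1 Eab]] := sub a b; have [c1 [d1 Ecd]] := sub c d.
have [x1 [y1 E]] := sub x y.
rewrite !fE (@inter_numE _ (fibres col) _ _ _ x y) ?mem_fibres ?inE //.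
rewrite (@inter_numE _ (fibres col1) _ _ _ x1 y1) ?inE ?E //.
- by rewrite !num_paths_fibre; apply: path_col.
- by rewrite -Eab mem_fibres.
- by rewrite -Ecd mem_fibres.
- by rewrite -E mem_fibres.
Qed.

(** * The plain colouring and its twists *)

Section TwistedColouring.
Variable K : finFieldType.
Hypothesis two_neq0 : 2 != 0 :> K.
Local Notation V := 'rV[K]_3.
Implicit Types (e : K) (u x y z : V) (eps : K -> K).

Lemma row3P x y :
  x 0 0 = y 0 0 -> x 0 1 = y 0 1 -> x 0 2 = y 0 2 -> x = y.
Proof.
move=> E0 E1 E2; apply/rowP=> -[[|[|[|//]]] lti].
- by rewrite (_ : Ordinal lti = 0) //; apply: val_inj.
- by rewrite (_ : Ordinal lti = 1) //; apply: val_inj.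
- by rewrite (_ : Ordinal lti = 2) //; apply: val_inj.
Qed.

Definition row3 (a b c : K) : V := \row_(i < 3) [:: a; b; c]`_i.

Lemma row30 a b c : row3 a b c 0 0 = a. Proof. by rewrite mxE. Qed.
Lemma row31 a b c : row3 a b c 0 1 = b. Proof. by rewrite mxE. Qed.
Lemma row32 a b c : row3 a b c 0 2 = c. Proof. by rewrite mxE. Qed.
Definition row3E := (row30, row31, row32).

(** A quadratic form invariant under the Jordan block. *)
Definition quad u : K := u 0 1 ^+ 2 - u 0 1 * u 0 2 - 2 * u 0 0 * u 0 2.

(** Slots without meaning are filled with 0. For nonzero [e] this gives three disjoint kinds of
    colour: (c, 0, q) with c nonzero, (0, h, 0) with h nonzero, and (0, 0, a). *)
Definition diff_colour e u : K * K * K :=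
  if u 0 2 != 0 then (u 0 2, 0, quad u)
  else (0, e * u 0 1, if u 0 1 != 0 then 0 else u 0 0).

(** The factor matters only if [x] and [y] lie in one plane, so reading it off at [x] breaks no
    symmetry. *)
Definition colour eps x y := diff_colour (eps (x 0 2)) (x - y).

(** The form [quad] is even, whereas the last slot of an in-plane colour is linear. *)
Definition colour_conv (k : K * K * K) : K * K * K :=
  let: (c, h, q) := k in (- c, - h, if c != 0 then q else - q).

Lemma sub_row x y i : (x - y) 0 i = x 0 i - y 0 i.
Proof. by rewrite !mxE. Qed.

Lemma colour_convK : involutive colour_conv.
Proof.
case=> [[c h] q]; rewrite /= oppr_eq0 !opprK.
by case: (c == 0) => //=; rewrite opprK.
Qed.

Lemma colour_C eps x y : colour eps y x = colour_conv (colour eps x y).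
Proof.
rewrite /colour /diff_colour -opprB; set u := x - y.
have u2 : u 0 2 = 0 -> y 0 2 = x 0 2.
  by rewrite /u sub_row => /eqP; rewrite subr_eq0 => /eqP.
have N i : (- u) 0 i = - u 0 i by rewrite !mxE.
rewrite /quad !N !oppr_eq0; case: eqP => [/u2-> | /eqP c0] /=.
  rewrite eqxx oppr0 /= mulrN; case: eqP => //= _; by rewrite oppr0.
rewrite c0 oppr0; congr (_, _, _); ring.
Qed.

Lemma colour_fst eps x y : (colour eps x y).1.1 = x 0 2 - y 0 2.
Proof. by rewrite /colour /diff_colour sub_row; case: eqP => [->|]. Qed.

Lemma colour_slantP eps x y (c q : K) : c != 0 ->
  reflect (x 0 2 - y 0 2 = c /\ quad (x - y) = q)
          (colour eps x y == (c, 0, q)).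
Proof.
move=> c0; rewrite /colour /diff_colour sub_row.
case: (eqVneq (x 0 2 - y 0 2) 0) => [E|nE] /=.
  rewrite !xpair_eqE eq_sym (negPf c0) /=; apply: ReflectF => -[E' _].
  by case/eqP: c0; rewrite -E' E.
rewrite !xpair_eqE eqxx andbT.
by apply: (iffP andP) => -[/eqP-> /eqP->].
Qed.

Lemma colour_midP eps x y (h : K) : (forall c, eps c != 0) -> h != 0 ->
  reflect (x 0 2 = y 0 2 /\ eps (x 0 2) * (x 0 1 - y 0 1) = h)
          (colour eps x y == (0, h, 0)).
Proof.
move=> eps0 h0; rewrite /colour /diff_colour !sub_row.
have E2 : reflect (x 0 2 = y 0 2) (x 0 2 - y 0 2 == 0).
  by rewrite subr_eq0; apply: eqP.
case: E2 => [E|nE] /=; last first.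
  rewrite !xpair_eqE [0 == h]eq_sym (negPf h0) andbF /=.
  by apply: ReflectF => -[].
rewrite !xpair_eqE eqxx /=; apply: (iffP andP) => [[/eqP-> _] // | [_ E1]].
split; first exact/eqP.
rewrite ifT //; apply: contraNneq h0 => E'; by rewrite -E1 E' mulr0.
Qed.

Definition scale_mid e x : V := row3 (x 0 0) (e * x 0 1) (x 0 2).

Lemma scale_midK e : e != 0 -> cancel (scale_mid e) (scale_mid e^-1).
Proof.
by move=> e0 x; apply: row3P; rewrite /scale_mid !row3E ?mulKf.
Qed.

Lemma scale_midVK e : e != 0 -> cancel (scale_mid e^-1) (scale_mid e).
Proof. by move=> e0 x; apply: row3P; rewrite /scale_mid !row3E ?mulVKf. Qed.

(** Inside a single plane the twist is only a change of the middle coordinate. *)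
Lemma colour_scale eps x y : (forall c, eps c != 0) -> x 0 2 = y 0 2 ->
  colour (fun=> 1) (scale_mid (eps (x 0 2)) x) (scale_mid (eps (x 0 2)) y) =
  colour eps x y.
Proof.
move=> eps0 E; rewrite /colour /diff_colour !sub_row !row3E E subrr eqxx /=.
by rewrite mul1r -mulrBr mulf_eq0 (negPf (eps0 _)).
Qed.

(** The twist alters only pairs with a nonzero middle label, and a nonzero factor cannot turn such a
    label into 0 or back. *)
Lemma colour_straight eps x y : (forall c, eps c != 0) ->
    (colour eps x y).1.2 = 0 \/ (colour (fun=> 1) x y).1.2 = 0 ->
  colour eps x y = colour (fun=> 1) x y.
Proof.
move=> eps0; rewrite /colour /diff_colour; case: ifP => //= _ H.
suff -> : (x - y) 0 1 = 0 by rewrite !mulr0.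
by case: H => /eqP; rewrite mulf_eq0 ?(negPf (eps0 _)) ?oner_eq0 => /eqP.
Qed.

(** * Normal forms of colours and uniqueness of paths *)

Lemma colour_mid_neq0 eps x y : (colour eps x y).1.2 != 0 ->
  colour eps x y = (0, (colour eps x y).1.2, 0).
Proof.
rewrite /colour /diff_colour; case: ifP => /= [_|_]; first by rewrite eqxx.
by rewrite mulf_eq0 => /norP[_ ->].
Qed.

Lemma colour_slant eps x y : (colour eps x y).1.1 != 0 ->
  colour eps x y = ((colour eps x y).1.1, 0, (colour eps x y).2).
Proof. by rewrite /colour /diff_colour; case: ifP => //= _; rewrite eqxx. Qed.

Lemma colour_neq0 eps x y : (colour eps x y).1.1 != 0 ->
  (colour eps x y).1.2 = 0.
Proof. by move/colour_slant->. Qed.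

(** The label [h] fixes the plane and the middle coordinate of the intermediate point. The equation
    for [q] is then linear in its first coordinate, with leading coefficient - 2 * c. *)
Lemma card_paths_mid_slant eps x y (h c q : K) :
    (forall c, eps c != 0) -> h != 0 -> c != 0 -> x 0 2 - y 0 2 = c ->
  #|paths (colour eps) (0, h, 0) (c, 0, q) x y| = 1%N.
Proof.
move=> eps0 h0 c0 xy.
(* Here [b] is the middle coordinate of z - y, and [a] the first coordinate of z. *)
pose b := x 0 1 - h / eps (x 0 2) - y 0 1.
pose a := y 0 0 + (b ^+ 2 - b * c - q) / (2 * c).
apply: (@card_unique _ _ (row3 a (y 0 1 + b) (x 0 2))) => z.
rewrite inE; split.
  case/andP=> /(colour_midP _ _ eps0 h0)[z2 z1] /(colour_slantP _ _ _ _ c0)[_].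
  rewrite /quad !sub_row -z2 xy => zq.
  have zb : z 0 1 = y 0 1 + b.
    by rewrite /b -z1; field; apply: eps0.
  apply: row3P; rewrite !row3E // /a -zq zb.
  by field; rewrite c0.
move->; apply/andP; split.
  apply/(colour_midP _ _ eps0 h0); rewrite !row3E; split=> //.
  by rewrite /b; field; apply: eps0.
apply/(colour_slantP _ _ _ _ c0); rewrite /quad !sub_row !row3E xy; split=> //.
by rewrite /a; field; rewrite c0.
Qed.

(** Reversal of paths; it yields the slant-mid count from the mid-slant one. *)
Lemma card_paths_conv eps k1 k2 x y :
  #|paths (colour eps) (colour_conv k1) (colour_conv k2) x y| =
  #|paths (colour eps) k2 k1 y x|.
Proof.
apply: eq_card => z; rewrite !inE andbC.
by rewrite (colour_C eps z x) (colour_C eps y z) !(can_eq colour_convK).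
Qed.

Lemma card_paths_slant_mid eps x y (h c q : K) :
    (forall c, eps c != 0) -> h != 0 -> c != 0 -> x 0 2 - y 0 2 = c ->
  #|paths (colour eps) (c, 0, q) (0, h, 0) x y| = 1%N.
Proof.
move=> eps0 h0 c0 xy; rewrite -card_paths_conv /= eqxx c0 !oppr0.
by apply: card_paths_mid_slant; rewrite ?oppr_eq0 // -xy opprB.
Qed.

(* Subtracting the two quadratic equations leaves an equation for [z 0 1]
   which is linear with leading coefficient [2 * (x 0 1 - y 0 1)]. *)
Lemma card_paths_slant_slant eps x y (c q1 q2 : K) :
    (forall c, eps c != 0) -> c != 0 -> x 0 2 = y 0 2 -> x 0 1 != y 0 1 ->
  #|paths (colour eps) (c, 0, q1) (- c, 0, q2) x y| = 1%N.
Proof.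
move=> eps0 c0 xy2 xy1.
have b0 : x 0 1 - y 0 1 != 0 by rewrite subr_eq0.
have nc0 : - c != 0 by rewrite oppr_eq0.
pose b := x 0 1 - y 0 1; pose a := x 0 0 - y 0 0.
(* [b1] and [a1] are coordinates of x - z: [b1] solves the linear equation, then [a1] the equation
   for [q1]. *)
pose b1 := (b ^+ 2 + b * c + 2 * a * c - q2 + q1) / (2 * b).
pose a1 := (b1 ^+ 2 - b1 * c - q1) / (2 * c).
apply: (@card_unique _ _ (row3 (x 0 0 - a1) (x 0 1 - b1) (x 0 2 - c))) => z.
rewrite inE; split.
  case/andP=> /(colour_slantP _ _ _ _ c0)[z2 zq1].
  case/(colour_slantP _ _ _ _ nc0)=> yz2; move: zq1.
  rewrite /quad !sub_row yz2 z2 => zq1 zq2.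
  have zb : z 0 1 = x 0 1 - b1.
    by rewrite /b1 /a /b -zq1 -zq2; field; rewrite b0.
  apply: row3P; rewrite !row3E //; last by rewrite -z2; ring.
  by rewrite /a1 -zq1 zb; field; rewrite c0.
move->; apply/andP; split.
  apply/(colour_slantP _ _ _ _ c0); rewrite /quad !sub_row !row3E.
  split; first by ring.
  by rewrite /a1; field; rewrite c0.
apply/(colour_slantP _ _ _ _ nc0); rewrite /quad !sub_row !row3E -xy2.
split; first by ring.
by rewrite /a1 /b1 /a /b; field; rewrite b0 c0 two_neq0.
Qed.

(** * Comparison of twisted and plain path counts *)

Local Notation plain := (colour (fun=> 1)).

Lemma paths_fst eps k1 k2 x y z : z \in paths (colour eps) k1 k2 x y ->
  k1.1.1 = x 0 2 - z 0 2 /\ k2.1.1 = z 0 2 - y 0 2.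
Proof. by rewrite inE => /andP[/eqP<- /eqP<-]; rewrite !colour_fst. Qed.

Lemma card_paths_fst_neq eps k1 k2 x y : k1.1.1 + k2.1.1 != x 0 2 - y 0 2 ->
  #|paths (colour eps) k1 k2 x y| = 0%N.
Proof.
move=> ne; apply: eq_card0 => z; apply/negP=> /paths_fst[E1 E2].
by case/eqP: ne; rewrite E1 E2 addrA subrK.
Qed.

(** With its converse below, this shows that both colourings attain the same colours: rescale a pair
    inside one plane, and keep any other pair. *)
Lemma plain_preimage eps x y : (forall c, eps c != 0) ->
  exists x' y', plain x' y' = colour eps x y.
Proof.
move=> eps0; have [E|nE] := eqVneq (x 0 2) (y 0 2).
  by do 2!eexists; apply: (colour_scale eps0 E).
exists x, y; apply/esym/colour_straight => //; left.
by apply: colour_neq0; rewrite colour_fst subr_eq0.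
Qed.

Lemma twisted_preimage eps x y : (forall c, eps c != 0) ->
  exists x' y', colour eps x' y' = plain x y.
Proof.
move=> eps0; have [E|nE] := eqVneq (x 0 2) (y 0 2).
  have e0 : (eps (x 0 2))^-1 != 0 by rewrite invr_eq0.
  exists (scale_mid (eps (x 0 2))^-1 x), (scale_mid (eps (x 0 2))^-1 y).
  by rewrite -colour_scale ?row32 // !scale_midVK.
exists x, y; apply/colour_straight => //; right.
by apply: colour_neq0; rewrite colour_fst subr_eq0.
Qed.

(* When all three relations lie inside the planes [x 0 2 = const], only one
   value of [eps] is involved and rescaling the middle coordinate undoes it. *)
Lemma card_paths_in_plane eps k1 k2 x y :
    (forall c, eps c != 0) -> k1.1.1 = 0 -> k2.1.1 = 0 -> x 0 2 = y 0 2 ->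
  #|paths (colour eps) k1 k2 x y| =
  #|paths plain k1 k2 (scale_mid (eps (x 0 2)) x) (scale_mid (eps (x 0 2)) y)|.
Proof.
move=> eps0 k10 k20 xy; set e := eps _.
have e0 : e != 0 by apply: eps0.
rewrite -(card_imset _ (can_inj (scale_midK e0))).
apply: eq_card => z; apply/imsetP/idP.
  case=> {}z zp ->; have [_ zy] := paths_fst zp; move: zp.
  rewrite k20 in zy; move/esym/eqP: zy; rewrite subr_eq0 => /eqP zy.
  rewrite !inE -(colour_scale eps0 (etrans xy (esym zy))) -/e.
  by rewrite -(colour_scale eps0 zy) zy -xy -/e.
move=> zp; have [_ zy] := paths_fst zp.
rewrite k20 row32 in zy; move/esym/eqP: zy; rewrite subr_eq0 => /eqP zy.
have E := scale_midVK e0 z.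
exists (scale_mid e^-1 z); last by rewrite E.
have zy' : scale_mid e^-1 z 0 2 = y 0 2 by rewrite row32.
rewrite inE -(colour_scale eps0 (etrans xy (esym zy'))) -/e E.
rewrite -(colour_scale eps0 zy') zy' -xy -/e E.
by move: zp; rewrite inE.
Qed.

Lemma card_paths_straight eps k1 k2 x y : (forall c, eps c != 0) ->
    k1.1.2 = 0 -> k2.1.2 = 0 ->
  #|paths (colour eps) k1 k2 x y| = #|paths plain k1 k2 x y|.
Proof.
move=> eps0 k10 k20; apply: eq_card => z; rewrite !inE.
have H a b k : k.1.2 = 0 -> (colour eps a b == k) = (plain a b == k).
  move=> k0; apply/eqP/eqP => E; rewrite -E.
    by apply/esym/colour_straight => //; left; rewrite E.
  by apply/colour_straight => //; right; rewrite E.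
by rewrite !H.
Qed.

(** A side of the triangle x, z, y with nonzero middle label lies in a plane, which forces the other
    two sides to be slanted. The cases are the three possible positions of that side. *)
Lemma card_paths_one eps k1 k2 x y :
    (forall c, eps c != 0) ->
    (forall k, k \in [:: k1; k2] -> exists a b, k = plain a b) ->
    k1.1.1 + k2.1.1 = x 0 2 - y 0 2 -> (k1.1.1 != 0) || (k2.1.1 != 0) ->
    [|| k1.1.2 != 0, k2.1.2 != 0 | (colour eps x y).1.2 != 0] ->
  #|paths (colour eps) k1 k2 x y| = 1%N.
Proof.
move=> eps0 kP kD.
have [a1 [b1 E1]] := kP k1 (mem_head _ _).
have [a2 [b2 E2]] : exists a b, k2 = plain a b.
  by apply: kP; rewrite !inE eqxx orbT.
have [h1 slant _|h1] := boolP (k1.1.2 != 0).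
  have Ek1 : k1 = (0, k1.1.2, 0) by rewrite E1 -colour_mid_neq0 -?E1.
  have {}slant : k2.1.1 != 0 by move: slant; rewrite Ek1 eqxx.
  have Ek2 : k2 = (k2.1.1, 0, k2.2) by rewrite E2 -colour_slant -?E2.
  rewrite Ek1 Ek2; apply: card_paths_mid_slant => //.
  by rewrite -kD Ek1 add0r.
have [h2 slant _|h2] := boolP (k2.1.2 != 0).
  have Ek2 : k2 = (0, k2.1.2, 0) by rewrite E2 -colour_mid_neq0 -?E2.
  have {}slant : k1.1.1 != 0 by move: slant; rewrite Ek2 eqxx orbF.
  have Ek1 : k1 = (k1.1.1, 0, k1.2) by rewrite E1 -colour_slant -?E1.
  rewrite Ek1 Ek2; apply: card_paths_slant_mid => //.
  by rewrite -kD Ek2 addr0.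
(* The in-plane side is now the pair (x, y) itself, so the two slanted steps have opposite
   heights. *)
move=> slant /= mid; have xyE := colour_mid_neq0 mid.
move: (introT eqP xyE) => /(colour_midP _ _ eps0 mid)[xy2 xy1].
have k2c : k2.1.1 = - k1.1.1.
  by apply/eqP; rewrite -addr_eq0 addrC kD xy2 subrr.
have c0 : k1.1.1 != 0 by move: slant; rewrite k2c oppr_eq0 orbb.
have c20 : k2.1.1 != 0 by rewrite k2c oppr_eq0.
have -> : k1 = (k1.1.1, 0, k1.2) by rewrite E1 -colour_slant -?E1.
have -> : k2 = (- k1.1.1, 0, k2.2) by rewrite -k2c E2 -colour_slant -?E2.
apply: card_paths_slant_slant => //.
by apply: contraNneq mid => xy; rewrite -xy1 xy subrr mulr0.
Qed.

(** If the heights do not add up, both counts are 0. If all sides are in-plane, rescaling applies.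
    If some are slanted and a middle label is nonzero, both counts are 1. Otherwise the twist
    changes no side. Constancy of the plain counts absorbs the change of end points. *)
Lemma card_paths_twist eps a b c d x y x' y' :
    (forall c, eps c != 0) ->
    (forall a b c d x y x' y', plain x y = plain x' y' ->
      #|paths plain (plain a b) (plain c d) x y| =
      #|paths plain (plain a b) (plain c d) x' y'|) ->
    plain x y = colour eps x' y' ->
  #|paths plain (plain a b) (plain c d) x y| =
  #|paths (colour eps) (plain a b) (plain c d) x' y'|.
Proof.
move=> eps0 plain_path xy; set k1 := plain a b; set k2 := plain c d.
have xyD : x 0 2 - y 0 2 = x' 0 2 - y' 0 2.
  by rewrite -(colour_fst (fun=> 1)) xy colour_fst.
have one0 : forall c : K, (fun=> 1 : K) c != 0 by move=> _; apply: oner_neq0.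
have [kD|kD] := eqVneq (k1.1.1 + k2.1.1) (x 0 2 - y 0 2); last first.
  by rewrite !card_paths_fst_neq -?xyD.
have kP k : k \in [:: k1; k2] -> exists a b, k = plain a b.
  by rewrite !inE => /orP[]/eqP->; do 2!eexists.
have [/andP[/eqP k10 /eqP k20]|] := boolP ((k1.1.1 == 0) && (k2.1.1 == 0)).
  have xy' : x' 0 2 = y' 0 2.
    by apply/eqP; rewrite -subr_eq0 -xyD -kD k10 k20 addr0.
  rewrite (card_paths_in_plane eps0 k10 k20 xy').
  by apply: plain_path; rewrite colour_scale.
rewrite negb_and => slant.
have [mid|] := boolP [|| k1.1.2 != 0, k2.1.2 != 0 | (plain x y).1.2 != 0].
  by rewrite !card_paths_one -?xyD -?xy.
rewrite !negb_or !negbK => /and3P[/eqP k10 /eqP k20 /eqP k0].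
rewrite (card_paths_straight _ _ eps0 k10 k20); apply: plain_path.
by rewrite xy; apply: colour_straight => //; left; rewrite -xy.
Qed.

(** * The twisted scheme and its failure to be Schurian *)

Lemma colour_diag eps x y : (forall c, eps c != 0) ->
  (colour eps x y == colour eps 0 0) = (x == y).
Proof.
move=> eps0.
have d0 e : diff_colour e 0 = (0, 0, 0).
  by rewrite /diff_colour !mxE !eqxx /= mulr0.
rewrite /colour subrr d0 -(subr_eq0 x y); set u := x - y.
apply/eqP/eqP => [|-> //].
rewrite /diff_colour; case: ifP => [u2 [] /eqP | /negbFE/eqP u2 []].
  by rewrite (negPf u2).
move/eqP; rewrite mulf_eq0 (negPf (eps0 _)) => /eqP u1.
by rewrite u1 eqxx => u0; apply: row3P; rewrite [RHS]mxE.
Qed.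

(* An automorphism moving the plane [x 0 2 = 0] to [x 0 2 = 1] moves
   [x 0 2 = 1] to [x 0 2 = 2]; it reverses the middle coordinate on the former
   plane but not on the latter, whereas the cross term of [quad] between
   the two planes forces both signs to agree. *)
Lemma twisted_not_schurian eps :
    (forall c, eps c != 0) -> eps 0 = -1 -> eps 1 = 1 -> eps 2 = 1 ->
  ~ schurian (fibres (colour eps)).
Proof.
move=> eps0 e0 e1 e2 /schurian_fibres/(_ 0 (row3 0 0 1))[g [g0 gP]].
have one0 : 1 != 0 :> K := oner_neq0 K.
pose P i j : V := row3 0 i j.
have P00 : 0 = P 0 0 by apply: row3P; rewrite /P row3E mxE.
rewrite P00 in g0.
have g2 i j : g (P i j) 0 2 = j + 1.
  have := congr1 (fun k => k.1.1) (gP (P i j) (P 0 0)).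
  by rewrite !colour_fst g0 !row3E subr0 => /eqP; rewrite subr_eq => /eqP.
have mid j : eps (j + 1) * (g (P 1 j) 0 1 - g (P 0 j) 0 1) = eps j.
  have : colour eps (P 1 j) (P 0 j) == (0, eps j, 0).
    by apply/(colour_midP _ _ eps0 (eps0 j)); rewrite !row3E subr0 mulr1.
  by rewrite -gP => /(colour_midP _ _ eps0 (eps0 j))[_]; rewrite g2.
have slant i j : quad (g (P i 1) - g (P j 0)) = quad (P i 1 - P j 0).
  have /(colour_slantP _ _ _ _ one0)[_ <- //] :
    colour eps (g (P i 1)) (g (P j 0)) == (1, 0, quad (P i 1 - P j 0)).
  by rewrite gP; apply/(colour_slantP _ _ _ _ one0); rewrite !row3E subr0.
have mid0 : g (P 1 0) 0 1 - g (P 0 0) 0 1 = -1.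
  by rewrite -e0 -(mid 0) add0r e1 mul1r.
have mid1 : g (P 1 1) 0 1 - g (P 0 1) 0 1 = 1.
  by rewrite -[RHS]e1 -(mid 1) -[1 + 1]/2 e2 mul1r.
(* The alternating sum is minus the polar form of [quad] at a - b and c - d; as these have last
   coordinate 0, only the middle product survives. *)
have cross (a b c d : V) : c 0 2 = d 0 2 -> a 0 2 = b 0 2 ->
    quad (a - c) - quad (a - d) - quad (b - c) + quad (b - d) =
    - 2 * (a 0 1 - b 0 1) * (c 0 1 - d 0 1).
  by move=> cd ab; rewrite /quad !sub_row cd ab; ring.
have := cross (g (P 1 1)) (g (P 0 1)) (g (P 1 0)) (g (P 0 0)).
rewrite !g2 !slant mid0 mid1 cross ?row3E // => /(_ erefl erefl) E.
(* The alternating sum is -2 at the original points and 2 at their images, a contradiction since 2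
   is nonzero. *)
move/eqP: E; rewrite -subr_eq0; apply/negP.
by rewrite (_ : _ - _ = - (2 * 2)) ?oppr_eq0 ?mulf_neq0 //; ring.
Qed.

Lemma twisted_scheme eps :
    (forall c, eps c != 0) -> association_scheme (fibres plain) ->
  association_scheme (fibres (colour eps)) /\
  same_intersection_numbers (fibres plain) (fibres (colour eps)).
Proof.
move=> eps0 sch.
have plain_path a b c d x y x' y' : plain x y = plain x' y' ->
    #|paths plain (plain a b) (plain c d) x y| =
    #|paths plain (plain a b) (plain c d) x' y'|.
  move=> xy; rewrite -!num_paths_fibre; case: sch => _ _ _ _.
  by move/(_ _ _ (fibre plain (plain x y))); apply;
    rewrite ?mem_fibres ?inE //= xy.
have sch' : association_scheme (fibres (colour eps)).
  apply: (fibres_scheme (x0 := 0) (conv := colour_conv)).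
  - by move=> x y; apply: colour_diag.
  - exact: colour_convK.
  - exact: colour_C.
  move=> a b c d x y x' y' xy.
  (* Both twisted counts are compared with one plain count, for plain pairs having the same
     colours. *)
  have [a1 [b1 <-]] := plain_preimage a b eps0.
  have [c1 [d1 <-]] := plain_preimage c d eps0.
  have [x1 [y1 E]] := plain_preimage x y eps0.
  rewrite -(card_paths_twist a1 b1 c1 d1 eps0 plain_path E).
  by apply: card_paths_twist; rewrite // -xy.
split=> //; apply: same_intersection_numbers_fibres => //.
- by move=> x y; apply: twisted_preimage.
- by move=> x y; apply: plain_preimage.
by move=> a b c d x y x1 y1; apply: card_paths_twist.
Qed.

End TwistedColouring.

(** * The orbitals of the Jordan group are the plain colour classes *)

Section JordanOrbitals.
Variable p : nat.
Hypothesis two_neq0 : 2 != 0 :> 'F_p.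
Local Notation V := 'rV['F_p]_3.
Local Notation J := (@jordan_fun p).
Local Notation plain := (@colour 'F_p (fun=> 1)).
Implicit Types u x y : V.

Lemma jordan0 u : J u 0 0 = u 0 0 + u 0 1. Proof. by rewrite mxE. Qed.
Lemma jordan1 u : J u 0 1 = u 0 1 + u 0 2. Proof. by rewrite mxE. Qed.
Lemma jordan2 u : J u 0 2 = u 0 2. Proof. by rewrite mxE. Qed.
Definition jordanE := (jordan0, jordan1, jordan2).

Lemma quad_jordan u : quad (J u) = quad u.
Proof. by rewrite /quad !jordanE; ring. Qed.

Lemma jordan_sub x y : J (x - y) = J x - J y.
Proof. by apply: row3P; rewrite ?jordanE !sub_row ?jordanE //; ring. Qed.

Lemma colour_jordan x y : plain (J x) (J y) = plain x y.
Proof.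
rewrite /colour -jordan_sub /diff_colour !jordanE quad_jordan.
by case: eqP => //= ->; rewrite addr0; case: eqP => //= ->; rewrite addr0.
Qed.

Lemma iter_jordan2 k u : iter k J u 0 2 = u 0 2.
Proof. by elim: k => //= k IH; rewrite jordanE. Qed.

Lemma iter_jordan1 k u : iter k J u 0 1 = u 0 1 + k%:R * u 0 2.
Proof.
elim: k => /= [|k IH]; first by rewrite mul0r addr0.
by rewrite jordanE IH iter_jordan2 -natr1; ring.
Qed.

Lemma iter_jordan0 k u : u 0 2 = 0 -> iter k J u 0 0 = u 0 0 + k%:R * u 0 1.
Proof.
move=> u2; elim: k => /= [|k IH]; first by rewrite mul0r addr0.
by rewrite jordanE IH iter_jordan1 u2 -natr1; ring.
Qed.

Lemma quad_iter_jordan k u : quad (iter k J u) = quad u.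
Proof. by elim: k => //= k IH; rewrite quad_jordan. Qed.

(** Iterating the Jordan map moves the coordinate just before the last nonzero one in arithmetic
    progression, so it reaches any value in the prime field. *)
Lemma iter_jordan_eq u u' :
  diff_colour 1 u = diff_colour 1 u' -> exists k, iter k J u = u'.
Proof.
have natK (a : 'F_p) : (a : nat)%:R = a by apply: natr_Zp.
rewrite /diff_colour !mul1r.
have [u2|u2] := eqVneq (u 0 2) 0; have [u2'|u2'] := eqVneq (u' 0 2) 0 => /=.
- case=> E1; rewrite -E1; have [u1|u1] := eqVneq (u 0 1) 0 => /= E0.
    by exists 0%N; apply: row3P; rewrite //= ?u2 ?u2'.
  exists ((u' 0 0 - u 0 0) / u 0 1 : 'F_p).
  apply: row3P; rewrite ?iter_jordan0 ?iter_jordan1 ?iter_jordan2 // ?natK.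
  - by field.
  - by rewrite u2 mulr0 addr0.
  by rewrite u2 u2'.
- by case=> E; rewrite -E eqxx in u2'.
- by case=> E; rewrite E eqxx in u2.
move=> E; have [E2 Eq] := (congr1 (fun k => k.1.1) E, congr1 snd E).
rewrite /= in E2 Eq; pose k : nat := (u' 0 1 - u 0 1) / u 0 2 : 'F_p.
exists k; set w := iter _ _ _.
have w2 : w 0 2 = u' 0 2 by rewrite iter_jordan2.
have w1 : w 0 1 = u' 0 1 by rewrite iter_jordan1 /k natK; field.
(* Once the last two coordinates agree, [quad] determines the first, which has coefficient - 2 * u'
   0 2. *)
apply: row3P => //; move: Eq; rewrite -(quad_iter_jordan k u) -/w /quad w1 w2.
move/addrI/oppr_inj/(mulIf u2')/mulfI; exact.
Qed.

Lemma jordan_group_colour (g : {perm V}) x y :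
  g \in jordan_group p -> plain (g x) (g y) = plain x y.
Proof.
suff sG : jordan_group p \subset colour_auts plain.
  by move/(subsetP sG)/colour_autsP.
rewrite gen_subG; apply/subsetP=> h; rewrite in_setU in_set1.
case/orP=> [/imsetP[t _ ->] | /eqP->]; apply/colour_autsP=> a b.
  by rewrite /colour !permE opprD addrACA subrr addr0.
by rewrite !permE colour_jordan.
Qed.

Lemma orbit_jordan_group x y x' y' :
  ((x', y') \in orbit (pair_action V) (jordan_group p) (x, y)) =
  (plain x' y' == plain x y).
Proof.
apply/orbitP/eqP => [[g gG [<- <-]] | xy]; first exact: jordan_group_colour.
have [k kE] := iter_jordan_eq (esym xy).
have tG t : translation t \in jordan_group p.
  by apply: mem_gen; rewrite inE imset_f.
have jG : jordan_perm p \in jordan_group p.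
  by apply: mem_gen; rewrite !inE eqxx orbT.
have jE u : iter k (jordan_perm p) u = iter k J u.
  by apply: eq_iter => v; rewrite permE.
(* Products act from left to right: y goes to 0, which the Jordan map fixes, and then to y'. *)
exists (translation (- y) * jordan_perm p ^+ k * translation y')%g.
  by rewrite !groupM ?groupX ?tG.
have J0 : iter k J 0 = 0.
  by elim: k {kE jE} => //= k ->; apply: row3P; rewrite jordanE !mxE ?addr0.
rewrite /= /pair_act /= !permM !permX !jE ![translation _ _]permE.
by rewrite subrr J0 kE subrK add0r.
Qed.

Lemma orbitals_jordan_group : orbitals (jordan_group p) = fibres plain.
Proof.
apply/setP=> s; apply/imsetP/imsetP => -[[x y] _ ->]; exists (x, y) => //;
by apply/setP=> -[x' y']; rewrite orbit_jordan_group !inE.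
Qed.

End JordanOrbitals.

Theorem theorem4p3 (p : nat) (p_prime : prime p) (p_odd : odd p) :
  exists (X : finType) (S : {set {set X * X}}),
    [/\ association_scheme S,
        ~ schurian S
      & same_intersection_numbers (orbitals (jordan_group p)) S].
Proof.
have two_neq0 : 2 != 0 :> 'F_p.
  rewrite -(dvdn_pcharf (pchar_Fp p_prime)).
  by rewrite dvdn_prime2 //; apply: contraTneq p_odd => ->.
pose eps (c : 'F_p) : 'F_p := if c == 0 then -1 else 1.
have eps0 c : eps c != 0.
  by rewrite /eps; case: ifP => _; rewrite ?oppr_eq0 oner_neq0.
have sch := orbitals_scheme (jordan_group_trans p).
rewrite (orbitals_jordan_group two_neq0) in sch *.
have [sch' same] := twisted_scheme two_neq0 eps0 sch.
exists 'rV['F_p]_3, (fibres (colour eps)); split=> //.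
by apply: twisted_not_schurian;
  rewrite // /eps ?eqxx ?oner_eq0 ?(negPf two_neq0).
Qed.
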